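(* Let $\pi_\theta^{\mathrm{mix}}$ be the mixed policy that follows the main policy $\pi_\theta$ at states in the safe region $\mathcal R(d)$ and a $\theta$-independent recovery policy $\pi^{\mathrm{rec}}$ (an arbitrary probability kernel, deterministic or stochastic) at states outside $\mathcal R(d)$. Let $J(\theta)$ and $J^{\mathrm{mix}}(\theta)$ be the expected discounted returns of $\pi_\theta$ and of $\pi_\theta^{\mathrm{mix}}$, respectively. Assume: (R1) for every $(s,a)$ on the support of the trajectory law $p_\theta^{\mathrm{mix}}$ with $s\in\mathcal R(d)$, $\pi_\theta(a\mid s)>0$ and $\theta\mapsto\log\pi_\theta(a\mid s)$ is differentiable; (R2) rewards are uniformly bounded, $|r_t|\le r_{\max}$; (R3) differentiation in $\theta$ and integration over trajectories commute in the gradient of the mixed-policy return (see context). Then $$|J(\theta)-J^{\mathrm{mix}}(\theta)|\le\frac{2\,r_{\max}}{(1-\gamma)^2}\,\beta(\theta,d),$$ where $\beta(\theta,d)=\Pr_{s\sim\nu^{\pi_\theta}}[s\notin\mathcal R(d)]$ is the out-of-region rate of the main policy under its own normalized discounted state-visitation distribution $\nu^{\pi_\theta}$.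
   Context: Setting: an infinite-horizon discounted Markov decision process with measurable state space $\mathcal S$ and measurable action space $\mathcal A$, initial state distribution $p$, transition kernel $P(\cdot\mid s,a)$, measurable reward $r(s,a)\in[-r_{\max},r_{\max}]$ and discount $\gamma\in(0,1)$. (Episode termination at failure states is modelled by absorption.) The safe region is $\mathcal R(d)=\{s:\mathcal D(s)\le d\}$ for a measurable function $\mathcal D:\mathcal S\to[0,\infty)$ and a fixed radius $d\ge0$. The main policy $\pi_\theta$ is a stochastic policy with density $\pi_\theta(a\mid s)$ with respect to a fixed reference measure $\lambda$ on $\mathcal A$, with $\theta$ in an open subset of a Euclidean space. $\pi_\theta^{\mathrm{mix}}(\cdot\mid s)$ equals $\pi_\theta(\cdot\mid s)$ if $s\in\mathcal R(d)$ and $\pi^{\mathrm{rec}}(\cdot\mid s)$ otherwise. Index time from $0$ with $s_0\sim p$. The trajectory laws $p_\theta$ and $p_\theta^{\mathrm{mix}}$ are those of the process $(s_t,a_t)_{t\ge0}$ with $a_t\sim\pi_\theta(\cdot\mid s_t)$, respectively $a_t\sim\pi_\theta^{\mathrm{mix}}(\cdot\mid s_t)$, and $s_{t+1}\sim P(\cdot\mid s_t,a_t)$. Put $r_t=r(s_t,a_t)$, $J(\theta)=\mathbb E_{p_\theta}[\sum_{t\ge0}\gamma^t r_t]$ and $J^{\mathrm{mix}}(\theta)=\mathbb E_{p_\theta^{\mathrm{mix}}}[\sum_{t\ge0}\gamma^t r_t]$. The normalized discounted state visitation of $\pi_\theta$ is $\nu^{\pi_\theta}(B)=(1-\gamma)\sum_{t\ge0}\gamma^t\Pr_{p_\theta}[s_t\in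 B]$ for measurable $B\subseteq\mathcal S$. Condition (R3) precisely: for every finite $H$, let $\Lambda_H$ be the $\theta$-independent reference measure $p(ds_0)\prod_{t=0}^{H}\kappa(da_t\mid s_t)P(ds_{t+1}\mid s_t,a_t)$ on length-$H$ trajectories, where $\kappa(\cdot\mid s)=\lambda$ for $s\in\mathcal R(d)$ and $\kappa(\cdot\mid s)=\pi^{\mathrm{rec}}(\cdot\mid s)$ otherwise, and $\rho_{\theta,H}=\prod_{t\le H:\,s_t\in\mathcal R(d)}\pi_\theta(a_t\mid s_t)$ the density of the mixed-policy trajectory law with respect to $\Lambda_H$; then $\rho_{\theta,H}$ is differentiable in $\theta$ for $\Lambda_H$-almost every trajectory and $\nabla_\theta\int\rho_{\theta,H}\,\big(\sum_{t\le H}\gamma^t r_t\big)\,d\Lambda_H=\int\nabla_\theta\rho_{\theta,H}\,\big(\sum_{t\le H}\gamma^t r_t\big)\,d\Lambda_H$. *)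

(* Defs.v *)
From HB Require Import structures.
From mathcomp Require Export all_boot all_order all_algebra.
From mathcomp Require Export all_classical all_reals all_analysis.
From mathcomp Require Export measurable_realfun.
Set Implicit Arguments.
Unset Strict Implicit.
Unset Printing Implicit Defensive.
Import Order.TTheory GRing.Theory Num.Theory.
Export numFieldNormedType.Exports.

Local Open Scope classical_set_scope.
Local Open Scope ring_scope.

(* The constant kernel at an s-finite (e.g. sigma-finite) measure. *)
Section kcst.
Local Open Scope ereal_scope.
Context d d' (X : measurableType d) (Y : measurableType d') (R : realType).

Definition kcst (m : {measure set Y -> \bar R}) (x : X) :
  {measure set Y -> \bar R} := m.

Let measurable_kcst m U : measurable U ->
  measurable_fun [set: X] ((kcst m) ^~ U).
Proof. by move=> mU; exact: measurable_cst. Qed.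

HB.instance Definition _ m := isKernel.Build _ _ X Y R (kcst m)
  (@measurable_kcst m).

Variable m : {sfinite_measure set Y -> \bar R}.

Let sfinite_kcst : exists2 s : (R.-ker X ~> Y)^nat,
  forall n, measure_fam_uub (s n) &
  forall x U, measurable U -> kcst m x U = kseries s x U.
Proof.
exists (fun n => kcst (sfinite_measure_seq m n)).
  move=> n; have fm : sfinite_measure_seq m n setT \is a fin_num.
    exact: fin_num_measure.
  exists (fine (sfinite_measure_seq m n setT) + 1)%R => x.
  by rewrite /kcst -[X in X < _](fineK fm) lte_fin ltrDl.
by move=> x U mU; rewrite /kcst/= sfinite_measure_seqP.
Qed.

HB.instance Definition _ :=
  isSFiniteKernel_subdef.Build _ _ X Y R (kcst m) sfinite_kcst.

End kcst.

(* k1 on the sublevel set {s | D s <= rad}, k2 elsewhere. *)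
Section kswitch.
Local Open Scope ereal_scope.
Context d d' (X : measurableType d) (Y : measurableType d') (R : realType).
Variables (D : {mfun X >-> R}) (rad : R).

Definition kswitch (k1 k2 : X -> {measure set Y -> \bar R}) (x : X) :
  {measure set Y -> \bar R} := if (D x <= rad)%R then k1 x else k2 x.

Lemma kswitchE k1 k2 x U :
  kswitch k1 k2 x U = if (D x <= rad)%R then k1 x U else k2 x U.
Proof. by rewrite /kswitch; case: (D x <= rad)%R. Qed.

Let measurable_kswitch (k1 k2 : R.-ker X ~> Y) U : measurable U ->
  measurable_fun [set: X] ((kswitch k1 k2) ^~ U).
Proof.
move=> mU.
rewrite [X in measurable_fun _ X](_ : _ =
    fun x => if (D x <= rad)%R then k1 x U else k2 x U); last first.
  by apply/funext => x; rewrite kswitchE.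
apply: measurable_fun_ifT => //.
- exact: measurable_fun_ler.
- exact: measurable_kernel.
- exact: measurable_kernel.
Qed.

HB.instance Definition _ (k1 k2 : R.-ker X ~> Y) :=
  isKernel.Build _ _ X Y R (kswitch k1 k2) (@measurable_kswitch k1 k2).

Variables k1 k2 : R.-sfker X ~> Y.

Let sfinite_kswitch : exists2 s : (R.-ker X ~> Y)^nat,
  forall n, measure_fam_uub (s n) &
  forall x U, measurable U -> kswitch k1 k2 x U = kseries s x U.
Proof.
have [s1 h1] := sfinite_kernel k1; have [s2 h2] := sfinite_kernel k2.
exists (fun n => kswitch (s1 n) (s2 n)).
  move=> n; have [r1 s1r1] := measure_uub (s1 n).
  have [r2 s2r2] := measure_uub (s2 n).
  exists (Num.max r1 r2) => x /=; rewrite kswitchE; case: ifP => _.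
    by rewrite (lt_le_trans (s1r1 x))// lee_fin le_max lexx.
  by rewrite (lt_le_trans (s2r2 x))// lee_fin le_max lexx orbT.
move=> x U mU; rewrite kswitchE h1// h2// /kseries/= /mseries.
by under [RHS]eq_eseriesr do rewrite kswitchE; case: ifP.
Qed.

HB.instance Definition _ :=
  isSFiniteKernel_subdef.Build _ _ X Y R (kswitch k1 k2) sfinite_kswitch.

End kswitch.

(* The measure m(dx) k(f x, dy) on X * Y. The library's [kproduct] is not used
   because it asks for finite kernels, whereas k may be the constant kernel at
   an infinite reference measure. *)
Section semidirect.
Local Open Scope ereal_scope.
Context d1 d2 d3 (X : measurableType d1) (Z : measurableType d2)
  (Y : measurableType d3) (R : realType).
Variables (m : {measure set X -> \bar R}) (f : {mfun X >-> Z})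
  (k : R.-sfker Z ~> Y).

Definition semidirect (E : set (X * Y)) : \bar R :=
  \int[m]_x k (f x) (xsection E x).

Let measurable_section E : measurable E ->
  measurable_fun [set: X] (fun x => k (f x) (xsection E x)).
Proof.
move=> mE; have [s ks] := sfinite_kernel k.
rewrite [X in measurable_fun _ X](_ : _ = (fun x =>
    mseries (s ^~ (f x)) 0 (xsection E x))); last first.
  by apply/funext => x; rewrite ks//; exact: measurable_xsection.
apply: ge0_emeasurable_sum => // n _.
rewrite [X in measurable_fun _ X](_ : _ =
    (fun z => s n z.2 (xsection
      ((fun u : X * Z * Y => (u.1.1, u.2)) @^-1` E) z)) \o
    (fun x => (x, f x))); last first.
  by apply/funext => x /=; congr (s n _ _).
apply: measurableT_comp; last exact: measurable_fun_pair.
have mG : measurable ((fun u : X * Z * Y => (u.1.1, u.2)) @^-1` E).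
  rewrite -[X in measurable X]setTI; apply: measurable_fun_pair => //.
  exact: measurableT_comp.
have [r sr] := measure_uub (s n).
pose sn : X * Z -> {measure set Y -> \bar R} := fun z => s n z.2.
have msn U : measurable U -> measurable_fun [set: X * Z] (sn ^~ U).
  move=> mU; rewrite /sn.
  by apply: (measurableT_comp (measurable_kernel (s n) U mU)) => //.
pose K := isKernel.Build _ _ _ _ _ sn msn.
pose sn' : R.-ker (X * Z) ~> Y := HB.pack sn K.
have usn : measure_fam_uub sn' by exists r => z; exact: sr.
pose sn'' : R.-fker (X * Z) ~> Y :=
  HB.pack (sn' : X * Z -> _) K (Kernel_isFinite.Build _ _ _ _ _ sn' usn).
have := @measurable_fun_xsection_finite_kernel _ _ _ _ _ sn''
  ((fun u : X * Z * Y => (u.1.1, u.2)) @^-1` E).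
by rewrite inE; apply.
Qed.

Let semidirect0 : semidirect set0 = 0.
Proof.
by apply: integral0_eq => x _; rewrite xsection0 measure0.
Qed.

Let semidirect_ge0 E : 0 <= semidirect E.
Proof. exact: integral_ge0. Qed.

Let semidirect_additive : semi_sigma_additive semidirect.
Proof.
move=> F mF tF mUF; rewrite [X in _ --> X](_ : _ =
    \sum_(0 <= i <oo) semidirect (F i)).
  by apply: is_cvg_nneseries => n _ _; exact: semidirect_ge0.
rewrite /semidirect -integral_nneseries//; last first.
  by move=> n; exact: measurable_section.
apply: eq_integral => x _; rewrite xsection_bigcup.
apply: measure_semi_bigcup => //.
- by move=> i; exact: measurable_xsection.
- exact: trivIset_xsection.
- by apply: bigcup_measurable => i _; exact: measurable_xsection.
Qed.

HB.instance Definition _ := isMeasure.Build _ _ _ semidirect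
  semidirect0 semidirect_ge0 semidirect_additive.

End semidirect.

Section histories.
Context dS dA (S : measurableType dS) (A : measurableType dA).

Fixpoint hist_display (n : nat) : measure_display :=
  if n is n'.+1 then ((hist_display n', dA).-prod, dS).-prod%mdisp else dS.

(* hist n is the space of (s_0, a_0, s_1, ..., a_{n-1}, s_n), nested to the
   left, with the product sigma-algebra. *)
Fixpoint hist (n : nat) : measurableType (hist_display n) :=
  match n with
  | 0 => S
  | n'.+1 => (hist n' * A * S)%type
  end.

Definition hist_last n : hist n -> S :=
  match n with
  | 0 => fun s => s
  | _.+1 => fun h => h.2
  end.

Lemma measurable_hist_last n : measurable_fun [set: hist n] (@hist_last n).
Proof. by case: n => [|n]; [exact: measurable_id|exact: measurable_snd]. Qed.

HB.instance Definition _ n :=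
  isMeasurableFun.Build _ _ _ _ (@hist_last n) (@measurable_hist_last n).

Definition hist_last_act n (x : hist n * A) : S * A := (hist_last x.1, x.2).

Lemma measurable_hist_last_act n :
  measurable_fun [set: hist n * A] (@hist_last_act n).
Proof.
apply: measurable_fun_pair => //.
by apply: measurableT_comp => //; exact: measurable_hist_last.
Qed.

HB.instance Definition _ n :=
  isMeasurableFun.Build _ _ _ _ (@hist_last_act n)
  (@measurable_hist_last_act n).

(* The pairs (s_0, a_0), ..., (s_{n-1}, a_{n-1}). *)
Fixpoint hist_steps (n : nat) : hist n -> seq (S * A) :=
  match n with
  | 0 => fun=> [::]
  | n'.+1 => fun h => rcons (hist_steps h.1.1) (hist_last_act h.1)
  end.

Fixpoint history (s : nat -> S) (a : nat -> A) (n : nat) : hist n :=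
  match n with
  | 0 => s 0
  | n'.+1 => (history s a n', a n', s n'.+1)
  end.

Context {R : realType}.

(* p(ds_0) \prod_(t < n) k(da_t | s_t) P(ds_{t+1} | s_t, a_t). *)
Fixpoint hist_measure (p : probability S R) (k : R.-sfker S ~> A)
    (P : R.-pker (S * A) ~> S) (n : nat) : {measure set (hist n) -> \bar R} :=
  match n with
  | 0 => p
  | n'.+1 => semidirect
      (semidirect (hist_measure p k P n') (@hist_last n') k)
      (@hist_last_act n') P
  end.

End histories.

Section decision_process.
Context dS dA (S : measurableType dS) (A : measurableType dA) {R : realType}.
Implicit Types (D : {mfun S >-> R}) (rad gamma : R).
Implicit Types (r : {mfun (S * A)%type >-> R}).

Definition safe_region D rad : set S := [set s | D s <= rad].

(* (s_t, a_t) is a trajectory of the policy pol: its finite-horizon marginals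
   are the laws p(ds_0) \prod_t pol(da_t | s_t) P(ds_{t+1} | s_t, a_t); by
   Ionescu-Tulcea such a process exists, and its law is determined. *)
Definition is_trajectory (p : probability S R) (P : R.-pker (S * A) ~> S)
    (pol : R.-sfker S ~> A) d (T : measurableType d) (Pr : probability T R)
    (s : nat -> {RV Pr >-> S}) (a : nat -> {RV Pr >-> A}) : Prop :=
  forall n (E : set (hist S A n)), measurable E ->
    Pr [set w | E (history (fun t => s t w) (fun t => a t w) n)] =
    hist_measure p pol P n E.

Definition expected_return gamma r d (T : measurableType d)
    (Pr : probability T R) (s : nat -> {RV Pr >-> S})
    (a : nat -> {RV Pr >-> A}) : \bar R :=
  'E_Pr[(fun w =>
    limn (series (fun t => gamma ^+ t * r (s t w, a t w))))%R]%E.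

Definition visitation gamma d (T : measurableType d) (Pr : probability T R)
    (s : nat -> {RV Pr >-> S}) (B : set S) : \bar R :=
  ((1 - gamma)%:E *
   \sum_(0 <= t <oo) (gamma ^+ t)%:E * distribution Pr (s t) B)%E.

Definition out_of_region_rate gamma D rad d (T : measurableType d)
    (Pr : probability T R) (s : nat -> {RV Pr >-> S}) : \bar R :=
  visitation gamma s (~` safe_region D rad).

(* No topology is given on S and A, so "on the support of the trajectory law"
   means on some measurable set of pairs carrying all the (s_t, a_t). *)
Definition carries d (T : measurableType d) (Pr : probability T R)
    (s : nat -> {RV Pr >-> S}) (a : nat -> {RV Pr >-> A})
    (Z : set (S * A)) : Prop :=
  measurable Z /\ forall t, Pr [set w | Z (s t w, a t w)] = 1%E.

Definition truncated_return gamma r n (h : hist S A n) : R :=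
  \sum_(t < n) gamma ^+ t * (map r (hist_steps h))`_t.

Section parametric_density.
Context {m : nat}.
Implicit Types (Theta : set 'rV[R]_m) (dens : 'rV[R]_m -> S -> A -> R).

(* dens th s is a density of the policy pol th at s, for th in Theta. *)
Definition has_density Theta (lam : {measure set A -> \bar R}) dens
    (pol : 'rV[R]_m -> R.-pker S ~> A) : Prop :=
  forall th, Theta th ->
    [/\ measurable_fun [set: S * A] (fun x => dens th x.1 x.2),
        forall s a, 0 <= dens th s a &
        forall s B, measurable B ->
          pol th s B = (\int[lam]_(a in B) (dens th s a)%:E)%E].

(* [ln] is 0 on nonpositive reals, so the first conjunct is needed for
   [ln \o f] to be the logarithm of f near th. *)
Definition log_differentiable (f : 'rV[R]_m -> R) (th : 'rV[R]_m) : Prop :=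
  (\forall th' \near th, 0 < f th') /\
  differentiable (fun th' => ln (f th')) th.

(* With n = H.+1, the product is over the safe times t <= H. *)
Definition mixed_density D rad dens (th : 'rV[R]_m) n (h : hist S A n) : R :=
  \prod_(x <- hist_steps h | D x.1 <= rad) dens th x.1 x.2.

(* grad_th \int rho_th G dmu = \int (grad_th rho_th) G dmu, both sides being
   meaningful; E is the conull set on which rho is differentiable at th. *)
Definition gradient_integral_commute d (X : measurableType d)
    (mu : {measure set X -> \bar R}) (rho : 'rV[R]_m -> X -> R) (G : X -> R)
    (th : 'rV[R]_m) : Prop :=
  let F th' := \int[mu]_(x in setT) (rho th' x * G x) in
  differentiable F th /\
  exists E : set X, [/\ measurable E, mu (~` E) = 0%E,
    forall x, E x -> differentiable (rho ^~ x) th &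
    forall i : 'I_m, let e := delta_mx 0 i in
      mu.-integrable E (fun x => ('D_e (rho ^~ x) th * G x)%:E) /\
      'D_e F th = \int[mu]_(x in E) ('D_e (rho ^~ x) th * G x)].

End parametric_density.
End decision_process.

(* Main.v *)
(** The two policies act identically as long as the process stays in the safe
    region, so the laws of the histories up to time t agree on the event that
    s_0, ..., s_t are all safe.  A reward bounded by rmax therefore has
    expectations at time t differing by at most 2 rmax times the probability
    that the main policy leaves the safe region by time t, which is at most
    b_0 + ... + b_t with b_u the main policy's probability of s_u being unsafe.
    Discounting and exchanging the sums gives
      sum_t gamma^t (b_0 + ... + b_t) <= (sum_u gamma^u b_u) / (1 - gamma),
    and the last sum is beta / (1 - gamma). *)
Require Import Defs.
From HB Require Import structures.
From mathcomp Require Import all_boot all_order all_algebra.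
From mathcomp Require Import all_classical all_reals all_analysis.
From mathcomp Require Import measurable_realfun.
From mathcomp Require Import ring.
Set Implicit Arguments.
Unset Strict Implicit.
Unset Printing Implicit Defensive.
Import Order.TTheory GRing.Theory Num.Theory.
Import numFieldNormedType.Exports.
Local Open Scope classical_set_scope.
Local Open Scope ring_scope.

(** * Measures agreeing on the measurable subsets of a set *)

Definition agree_on d (X : measurableType d) (R : realType)
    (m1 m2 : set X -> \bar R) (C : set X) : Prop :=
  forall E, measurable E -> E `<=` C -> m1 E = m2 E.

(** Sections of [E] over points outside [C] are empty, so both masses of [E] are integrals over [C],
    where the base measures and the kernels coincide. *)
Lemma agree_on_semidirect d1 d2 d3 (X : measurableType d1)
    (Z : measurableType d2) (Y : measurableType d3) (R : realType)
    (m1 m2 : {measure set X -> \bar R}) (f : {mfun X >-> Z})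
    (k1 k2 : R.-sfker Z ~> Y) (C : set X) :
    agree_on m1 m2 C -> (forall x, C x -> k1 (f x) = k2 (f x)) ->
  agree_on (semidirect m1 f k1) (semidirect m2 f k2) [set u | C u.1].
Proof.
move=> m12 k12 E mE EC.
have cut (m : {measure set X -> \bar R}) (k : R.-sfker Z ~> Y) :
    semidirect m f k E = (\int[m]_(x in C) k (f x) (xsection E x))%E.
  rewrite /semidirect [RHS]integral_mkcond; apply: eq_integral => x _.
  rewrite patchE; case: ifPn => // /negP Cx.
  rewrite (_ : xsection E x = set0) ?measure0//.
  by apply/seteqP; split=> y //; rewrite /xsection/= inE => /EC/= /mem_set.
rewrite !cut (eq_measure_integral m2)//; last first.
by apply: eq_integral => x /set_mem Cx; rewrite k12.
Qed.

(** * Histories that stay in the safe region *)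

Section safe_histories.
Context dS dA (S : measurableType dS) (A : measurableType dA) {R : realType}.
Variables (D : {mfun S >-> R}) (d : R).

(** The final state is left free, since [hist_steps] stops before it: no action has been drawn there
    yet, so its safety cannot affect the law of the history. *)
Definition safe_history n : set (hist S A n) :=
  [set h | all (fun x => D x.1 <= d) (hist_steps h)].

(** The cylinder over [h.1.1] has the shape of the conclusion of [agree_on_semidirect]. *)
Lemma safe_historyS n :
  safe_history (n := n.+1) =
  [set h | [set h | safe_history h /\ D (hist_last h) <= d] h.1.1].
Proof.
apply/seteqP; split=> h; rewrite /safe_history/= all_rcons.
  by move=> /andP[].
by move=> [-> ->].
Qed.

Lemma measurable_safe_history n : measurable (@safe_history n).
Proof.
have mlast k : measurable [set h : hist S A k | D (hist_last h) <= d].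
  rewrite (_ : [set h | _] = (D \o @hist_last _ _ S A k) @^-1` `]-oo, d]).
    rewrite -[X in measurable X]setTI.
    have mD : measurable_fun setT (D \o @hist_last _ _ S A k).
      exact: measurableT_comp.
    exact: mD.
  by apply/seteqP; split=> h /=; rewrite in_itv.
elim: n => [|n IH].
  by rewrite (_ : @safe_history 0 = setT)//; apply/seteqP.
have m11 : measurable_fun setT (fun h : hist S A n.+1 => h.1.1).
  exact: measurableT_comp.
rewrite safe_historyS -[X in measurable X]setTI; apply: m11 => //.
by apply: measurableI => //; exact: mlast.
Qed.

Lemma agree_on_safe_history (p : probability S R) (P : R.-pker (S * A) ~> S)
    (k1 k2 : R.-pker S ~> A) n :
  agree_on (hist_measure p k1 P n) (hist_measure p (kswitch D d k1 k2) P n)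
    (@safe_history n).
Proof.
elim: n => [|n IH]; first by [].
pose C := [set h : hist S A n | safe_history h /\ D (hist_last h) <= d].
(* One time step is two semidirect products; the outer one, the transition [P], is common to both
   laws. *)
rewrite safe_historyS; apply: (@agree_on_semidirect _ _ _ _ _ _ _ _ _ _ _ _
  [set u : hist S A n * A | C u.1]) => //.
apply: (@agree_on_semidirect _ _ _ _ _ _ _ _ _ _ _ _ C).
  by move=> E mE EC; apply: (IH E mE) => h /EC[].
(* On [C] the last state is safe, so [kswitch] selects [k1] there. *)
by move=> h [_ hd]; rewrite /= /kswitch ifT.
Qed.

End safe_histories.

(** * Discounted sums and integrals of bounded functions *)

Lemma sum_geometric_prefix (R : comPzRingType) (x : R) (b : nat -> R) n :
  (1 - x) * \sum_(t < n) x ^+ t * (\sum_(u < t.+1) b u) +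
    x ^+ n * (\sum_(u < n) b u) = \sum_(u < n) x ^+ u * b u.
Proof.
elim: n => [|n IH]; first by rewrite !big_ord0 !mulr0 addr0.
rewrite [RHS]big_ord_recr/= -IH big_ord_recr/=.
by rewrite [\sum_(u < n.+1) b u]big_ord_recr/= exprS; ring.
Qed.

Section bounded_functions.
Context d (T : measurableType d) (R : realType).

Lemma integrable_le (mu : probability T R) (f : T -> R) (c : R) (C : set T) :
    measurable C -> measurable_fun setT f -> (forall x, `|f x| <= c) ->
  mu.-integrable C (EFin \o f).
Proof.
move=> mC mf fc; apply: measurable_bounded_integrable => //.
- by rewrite (le_lt_trans (probability_le1 _ _))// ltry.
- exact: measurable_funTS.
- exists c; split; first exact: num_real.
  by move=> M cM x _; rewrite /= (le_trans (fc x))// ltW.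
Qed.

(** The integrals over [C] cancel, and each of the two remaining ones is at most [c] times the mass
    of the complement, whence the factor 2. *)
Lemma Rintegral_agree_on_le (mu nu : probability T R) (f : T -> R) (c : R)
    (C : set T) :
    measurable C -> agree_on mu nu C -> measurable_fun setT f ->
    (forall x, `|f x| <= c) ->
  `|\int[mu]_x f x - \int[nu]_x f x| <= 2 * c * fine (mu (~` C)).
Proof.
move=> mC munu mf fc.
have mC' := measurableC mC.
have split_C (m : probability T R) :
    \int[m]_x f x = \int[m]_(x in C) f x + \int[m]_(x in ~` C) f x.
  rewrite -Rintegral_setU ?setUv//.
    by apply: (@integrable_le _ _ c) => //; exact: measurableU.
  by rewrite disj_set2E setICr.
have tail (m : probability T R) :
    `|\int[m]_(x in ~` C) f x| <= c * fine (m (~` C)).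
  have fi := integrable_le m mC' mf fc.
  rewrite (le_trans (le_normr_Rintegral _ fi))// -Rintegral_cst//.
  apply: le_Rintegral => //.
  - exact: (integrable_norm fi).
  - by apply: (@integrable_le _ (cst c) `|c|).
rewrite !split_C.
rewrite (_ : \int[mu]_(x in C) f x = \int[nu]_(x in C) f x); last first.
  by rewrite /Rintegral (eq_measure_integral nu).
(* Both total masses are 1, so agreement on [C] itself forces equal masses of its complement. *)
have nuC : nu (~` C) = mu (~` C) by rewrite !probability_setC// munu.
rewrite opprD addrACA subrr add0r (le_trans (ler_normB _ _))//.
by rewrite -mulrA mulr_natl mulr2n lerD// -nuC.
Qed.

(** Dominated convergence with the constant [c / (1 - x)]; comparing returns thereby reduces to
    comparing finite sums of expectations. *)
Lemma expectation_discounted (Pr : probability T R) (x c : R)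
    (X : nat -> T -> R) :
    0 <= x < 1 -> (forall t, measurable_fun setT (X t)) ->
    (forall t w, `|X t w| <= c) ->
  exists2 J : R,
    'E_Pr[(fun w => limn (series (fun t => x ^+ t * X t w)))%R]%E = J%:E &
    (fun n => \sum_(t < n) x ^+ t * \int[Pr]_w X t w) @ \oo --> J.
Proof.
move=> /andP[x0 x1] mX Xc.
have c0 : 0 <= c by rewrite (le_trans (normr_ge0 _) (Xc 0 point)).
pose Y n w := \sum_(t < n) x ^+ t * X t w.
have YE w : series (fun t => x ^+ t * X t w) = Y ^~ w.
  by apply/funext => n; rewrite /series/= big_mkord.
have nx1 : `|x| < 1 by rewrite ger0_norm.
have term_le t w : `|x ^+ t * X t w| <= geometric c x t.
  by rewrite normrM normrX (ger0_norm x0) /= mulrC ler_wpM2r// exprn_ge0.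
have mY n : measurable_fun setT (Y n).
  by apply: measurable_sum => t; exact: measurable_funM.
(* Comparison with a geometric series makes [limn] a genuine limit and not a default value. *)
have cvgY w : cvgn (Y ^~ w).
  rewrite -YE; apply: normed_cvg.
  apply: (@series_le_cvg _ _ (geometric c x)) => [t|t|t|].
  - exact: normr_ge0.
  - exact: le_trans (term_le t w).
  - exact: term_le.
  - exact: is_cvg_geometric_series.
have Yle n w : `|Y n w| <= c / (1 - x).
  rewrite (le_trans (ler_norm_sum _ _ _))//.
  rewrite (@le_trans _ _ (\sum_(t < n) geometric c x t))//.
    by apply: ler_sum => t _; exact: term_le.
  rewrite /geometric/= -mulr_sumr ler_wpM2l//.
  rewrite -[leRHS]mul1r ler_pdivlMr ?subr_gt0// mulrC -opprB mulNr -subrX1.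
  by rewrite opprB gerBl exprn_ge0.
have intX t : Pr.-integrable setT (EFin \o X t).
  exact: (integrable_le Pr measurableT (mX t) (Xc t)).
have [] := @dominated_convergence _ _ _ Pr setT measurableT
  (fun n w => (Y n w)%:E) (fun w => (limn (Y ^~ w))%:E) (cst (c / (1 - x))%:E).
- by move=> n; exact/measurable_EFinP.
- apply/measurable_EFinP; apply: (@measurable_fun_cvg _ _ _ _ Y) => // w _.
- by apply: aeW => w _; apply: cvg_EFin; [exact: nearW|exact: cvgY].
- by apply: (@integrable_le _ (cst (c / (1 - x))) `|c / (1 - x)|).
- by apply: aeW => w n _; rewrite lee_fin.
move=> iL _ cvgE.
exists (\int[Pr]_w limn (Y ^~ w)).
  rewrite unlock fineK; last exact: integrable_fin_num.
  by apply: eq_integral => w _; rewrite YE.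
(* The convergence obtained is in the extended reals; since the limit is finite, [fine] carries it
   over to [R]. *)
rewrite (_ : (fun n => _) = fine \o (fun n => \int[Pr]_w (Y n w)%:E)%E).
  apply: fine_cvg; rewrite fineK; last exact: integrable_fin_num.
  exact: cvgE.
apply/funext => n /=; rewrite /Y.
under [in RHS]eq_integral do rewrite -sumEFin.
have intxX t : Pr.-integrable setT (EFin \o (fun w => x ^+ t * X t w)).
  apply: (@integrable_le _ _ (geometric c x t)) => //.
  exact: measurable_funM.
rewrite integral_sum//; last by move=> t; exact: intxX.
rewrite -sum_fine; last by move=> t _; exact: integrable_fin_num (intxX t).
by apply: eq_bigr => t _; rewrite -RintegralZl.
Qed.

End bounded_functions.

(** * Trajectories as history-valued random variables *)

Section trajectories.
Context dS dA (S : measurableType dS) (A : measurableType dA) {R : realType}.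

Section history_rv.
Context d (T : measurableType d) (Pr : probability T R).
Variables (s : nat -> {RV Pr >-> S}) (a : nat -> {RV Pr >-> A}).

Definition history_rv n (w : T) : hist S A n :=
  history (fun t => s t w) (fun t => a t w) n.

Lemma measurable_history_rv n : measurable_fun setT (history_rv n).
Proof.
elim: n => [|n IH]; first exact: measurable_funPT.
apply: measurable_fun_pair; last exact: measurable_funPT.
by apply: measurable_fun_pair; last exact: measurable_funPT.
Qed.

HB.instance Definition _ n :=
  isMeasurableFun.Build _ _ _ _ (history_rv n) (@measurable_history_rv n).

End history_rv.

Lemma hist_last_history (s : nat -> S) (a : nat -> A) n :
  hist_last (history s a n) = s n.
Proof. by case: n. Qed.

Lemma safe_history_history (D : {mfun S >-> R}) (d : R)
    (s : nat -> S) (a : nat -> A) n :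
  safe_history D d (history s a n) <-> forall t, (t < n)%N -> D (s t) <= d.
Proof.
rewrite /safe_history/=; elim: n => [|n IH]; first by split.
rewrite /= all_rcons /= hist_last_history; split.
  by move=> /andP[sn /IH st] t; rewrite ltnS leq_eqVlt => /predU1P[->|/st].
by move=> st; apply/andP; split; [exact: st|apply/IH => t /ltnW; exact: st].
Qed.

(** * Comparison of a policy with its switched version *)

Section comparison.
Variables (p : probability S R) (P : R.-pker (S * A) ~> S).
Variables (D : {mfun S >-> R}) (d : R) (k1 k2 : R.-pker S ~> A).
Context d1 (T1 : measurableType d1) (Pr1 : probability T1 R).
Variables (s1 : nat -> {RV Pr1 >-> S}) (a1 : nat -> {RV Pr1 >-> A}).
Context d2 (T2 : measurableType d2) (Pr2 : probability T2 R).
Variables (s2 : nat -> {RV Pr2 >-> S}) (a2 : nat -> {RV Pr2 >-> A}).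
Hypothesis traj1 : is_trajectory p P k1 s1 a1.
Hypothesis traj2 : is_trajectory p P (kswitch D d k1 k2) s2 a2.

(** The number b_t of the outline, as a real. *)
Let unsafe t := fine (distribution Pr1 (s1 t) (~` safe_region D d)).

Lemma measurable_safe_region : measurable (safe_region D d).
Proof.
rewrite (_ : safe_region D d = D @^-1` `]-oo, d]).
  by rewrite -[X in measurable X]setTI; exact: measurable_funPT.
by apply/seteqP; split=> h /=; rewrite in_itv.
Qed.

Let unsafeE t :
  (unsafe t)%:E = distribution Pr1 (s1 t) (~` safe_region D d).
Proof.
by rewrite fineK// fin_num_measure//; exact/measurableC/measurable_safe_region.
Qed.

(** Union bound over the times t < n at which the state may be unsafe. *)
Lemma unsafe_history_le n :
  fine (Pr1 [set w |
    ~ safe_history D d (history_rv s1 a1 n w)]) <=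
  \sum_(t < n) unsafe t.
Proof.
have mU t : measurable (s1 t @^-1` (~` safe_region D d)).
  rewrite -[X in measurable X]setTI; apply: measurable_funPT => //.
  exact/measurableC/measurable_safe_region.
rewrite -lee_fin fineK; last first.
  apply: fin_num_measure.
  have := measurable_history_rv s1 a1 measurableT
    (measurableC (@measurable_safe_history _ _ S A _ D d n)).
  by rewrite setTI.
rewrite -sumEFin; under eq_bigr do rewrite unsafeE.
rewrite (_ : [set w | _] =
    \big[setU/set0]_(t < n) s1 t @^-1` (~` safe_region D d)).
  exact: (@Boole_inequality _ _ _ Pr1
    (fun t => s1 t @^-1` (~` safe_region D d)) n (fun t _ => mU t)).
rewrite -(bigcup_mkord n (fun t => s1 t @^-1` (~` safe_region D d))).
apply/seteqP; split=> w /=.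
  rewrite safe_history_history => /existsNP[t /not_implyP[tn st]].
  by exists t.
by move=> [t /= tn st]; rewrite safe_history_history => /(_ t tn).
Qed.

Lemma Rintegral_reward_le (r : {mfun (S * A)%type >-> R}) (c : R) t :
    (forall x, `|r x| <= c) ->
  `|\int[Pr1]_w r (s1 t w, a1 t w) - \int[Pr2]_w r (s2 t w, a2 t w)| <=
  2 * c * \sum_(u < t.+1) unsafe u.
Proof.
move=> rc.
(* Index [t.+1] is the first at which the history contains the action at time t; [f] then discards
   the final state. *)
pose h1 : {RV Pr1 >-> hist S A t.+1} := history_rv s1 a1 t.+1.
pose h2 : {RV Pr2 >-> hist S A t.+1} := history_rv s2 a2 t.+1.
pose f (h : hist S A t.+1) := r (hist_last_act h.1).
have mf : measurable_fun setT f.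
  apply: (measurableT_comp (@measurable_funPT _ _ _ _ r)).
  apply: (measurableT_comp
    (@measurable_funPT _ _ _ _ (@hist_last_act _ _ S A t))).
  exact: measurable_fst.
have fc h : `|f h| <= c by exact: rc.
(* The two processes may live on different probability spaces; their laws are compared on the common
   space of histories. *)
have transfer dT (T : measurableType dT) (Pr : probability T R)
    (h : {RV Pr >-> hist S A t.+1}) :
    \int[Pr]_w f (h w) = \int[distribution Pr h]_y f y.
  rewrite /Rintegral integral_distribution//; first exact/measurable_EFinP.
  apply: (@integrable_le _ _ _ Pr (f \o h) c) => //.
    exact: measurableT_comp.
  by move=> w; exact: fc.
have fE1 : \int[Pr1]_w r (s1 t w, a1 t w) = \int[Pr1]_w f (h1 w).
  by apply: eq_Rintegral => w _; rewrite /f /hist_last_act/= hist_last_history.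
have fE2 : \int[Pr2]_w r (s2 t w, a2 t w) = \int[Pr2]_w f (h2 w).
  by apply: eq_Rintegral => w _; rewrite /f /hist_last_act/= hist_last_history.
have c0 : 0 <= c by exact: le_trans (normr_ge0 _) (rc point).
rewrite fE1 fE2 !transfer.
apply: (@le_trans _ _
    (2 * c * fine (distribution Pr1 h1 (~` @safe_history _ _ S A R D d t.+1)))).
  apply: Rintegral_agree_on_le => //; first exact: measurable_safe_history.
  move=> E mE ES; rewrite [LHS]traj1// [RHS]traj2//.
  exact: (@agree_on_safe_history _ _ _ _ _ _ _ _ _ _ _ t.+1).
by rewrite ler_wpM2l ?mulr_ge0//; exact: unsafe_history_le.
Qed.

(** The bound holds for the partial sums at every horizon [n], with a right-hand side independent of
    [n], and so passes to the limit. *)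
Lemma expected_return_sub_le (r : {mfun (S * A)%type >-> R}) (gamma c : R) :
    0 < gamma < 1 -> (forall x, `|r x| <= c) ->
  (`|expected_return gamma r s1 a1 - expected_return gamma r s2 a2| <=
   (2 * c / (1 - gamma) ^+ 2)%:E * out_of_region_rate gamma D d s1)%E.
Proof.
move=> /andP[g0 g1] rc.
have c0 : 0 <= c by exact: le_trans (normr_ge0 _) (rc point).
have g01 : 0 <= gamma < 1 by rewrite ltW.
have g1' : 0 < 1 - gamma by rewrite subr_gt0.
have mr dT (T : measurableType dT) (Pr : probability T R)
    (s : nat -> {RV Pr >-> S}) (a : nat -> {RV Pr >-> A}) t :
    measurable_fun setT (fun w => r (s t w, a t w)).
  apply: (measurableT_comp (@measurable_funPT _ _ _ _ r)).
  by apply: measurable_fun_pair; exact: measurable_funPT.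
have [J1 EJ1 cvg1] := expectation_discounted Pr1
  (X := fun t w => r (s1 t w, a1 t w)) g01 (mr _ _ _ s1 a1) (fun t w => rc _).
have [J2 EJ2 cvg2] := expectation_discounted Pr2
  (X := fun t w => r (s2 t w, a2 t w)) g01 (mr _ _ _ s2 a2) (fun t w => rc _).
rewrite /expected_return EJ1 EJ2 -EFinB abse_EFin.
have cvg12 : (fun n =>
    `|\sum_(t < n) gamma ^+ t * \int[Pr1]_w r (s1 t w, a1 t w) -
    \sum_(t < n) gamma ^+ t * \int[Pr2]_w r (s2 t w, a2 t w)|%:E) @ \oo -->
    `|J1 - J2|%:E.
  apply: cvg_EFin; first exact: nearW.
  exact: cvg_norm (cvgB cvg1 cvg2).
apply: cvge_le cvg12; apply: nearW => n /=.
have gn0 t : 0 <= gamma ^+ t by rewrite exprn_ge0// ltW.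
have unsafe0 t : 0 <= unsafe t by exact: fine_ge0.
(* The inner factor [1 - gamma] is the normalization of the visitation measure; it accounts for one
   of the two powers in the denominator, the exchange of sums for the other. *)
apply: (@le_trans _ _ (2 * c / (1 - gamma) ^+ 2 *
    ((1 - gamma) * \sum_(t < n) gamma ^+ t * unsafe t))%:E).
  rewrite lee_fin -sumrB.
  apply: (@le_trans _ _ (\sum_(t < n) gamma ^+ t *
      (2 * c * \sum_(u < t.+1) unsafe u))).
    rewrite (le_trans (ler_norm_sum _ _ _))//; apply: ler_sum => t _.
    rewrite -mulrBr normrM ger0_norm// ler_wpM2l//.
    exact: Rintegral_reward_le.
  rewrite -sum_geometric_prefix.
  under eq_bigr do rewrite mulrCA; rewrite -mulr_sumr.
  set X := \sum_(t < n) _; set Y := \sum_(u < n) _.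
  have -> : 2 * c / (1 - gamma) ^+ 2 *
      ((1 - gamma) * ((1 - gamma) * X + gamma ^+ n * Y)) =
      2 * c * X + 2 * c / (1 - gamma) * (gamma ^+ n * Y).
    by field; rewrite gt_eqF.
  (* The excess is the nonnegative boundary term. *)
  rewrite lerDl !mulr_ge0 ?invr_ge0 ?(ltW g1')//.
  exact: sumr_ge0.
rewrite !EFinM lee_wpmul2l//.
  by rewrite lee_fin !mulr_ge0 ?invr_ge0 ?exprn_ge0 ?(ltW g1').
rewrite /out_of_region_rate /visitation lee_wpmul2l ?lee_fin ?(ltW g1')//.
(* A partial sum of the nonnegative visitation series is at most its total. *)
have := @nneseries_lim_ge R
  (fun t => (gamma ^+ t)%:E * distribution Pr1 (s1 t) (~` safe_region D d))%E
  predT 0 n.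
rewrite big_mkord => H; apply: le_trans (H _); last first.
  by move=> k _ _; rewrite mule_ge0// lee_fin.
by rewrite -sumEFin; apply: lee_sum => t _; rewrite EFinM unsafeE.
Qed.

End comparison.
End trajectories.

Theorem theorem4 (R : realType) (dS dA : measure_display)
  (S : measurableType dS) (A : measurableType dA)
  (p : probability S R) (P : R.-pker (S * A) ~> S)
  (r : {mfun (S * A)%type >-> R}) (rmax gamma : R)
  (hgamma : 0 < gamma < 1)
  (D : {mfun S >-> R}) (hD : forall s, 0 <= D s) (d : R) (hd : 0 <= d)
  (lambda : {sfinite_measure set A -> \bar R})
  (m : nat) (Theta : set 'rV[R]_m) (hTheta : open Theta)
  (dens : 'rV[R]_m -> S -> A -> R) (pol : 'rV[R]_m -> R.-pker S ~> A)
  (hpol : has_density Theta lambda dens pol)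
  (prec : R.-pker S ~> A)
  (theta : 'rV[R]_m) (htheta : Theta theta)
  (* trajectories of the main policy *)
  (d1 : measure_display) (T1 : measurableType d1) (Pr1 : probability T1 R)
  (s1 : nat -> {RV Pr1 >-> S}) (a1 : nat -> {RV Pr1 >-> A})
  (hmain : is_trajectory p P (pol theta) s1 a1)
  (* trajectories of the mixed policy *)
  (d2 : measure_display) (T2 : measurableType d2) (Pr2 : probability T2 R)
  (s2 : nat -> {RV Pr2 >-> S}) (a2 : nat -> {RV Pr2 >-> A})
  (hmix : is_trajectory p P (kswitch D d (pol theta) prec) s2 a2)
  (R1 : exists Z, carries s2 a2 Z /\
    forall s a, Z (s, a) -> safe_region D d s ->
      0 < dens theta s a /\ log_differentiable (fun th => dens th s a) theta)
  (R2 : forall s a, `|r (s, a)| <= rmax)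
  (R3 : forall H : nat,
    gradient_integral_commute
      (hist_measure p (kswitch D d (kcst lambda) prec) P H.+1)
      (fun th h => mixed_density D d dens th h)
      (fun h => truncated_return gamma r h) theta) :
  (`|expected_return gamma r s1 a1 - expected_return gamma r s2 a2| <=
   (2 * rmax / (1 - gamma) ^+ 2)%:E * out_of_region_rate gamma D d s1)%E.
Proof.
(* Here [k1] is the main policy at [theta] and [k2] the recovery policy. *)
exact: (expected_return_sub_le hmain hmix hgamma (fun '(s, a) => R2 s a)).
Qed.
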